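(* For any finite simple graphs $G$ and $H$, $$\lambda(G \times H) = \min\{\,2\lambda(G)|E(H)|,\; 2\lambda(H)|E(G)|,\; \delta(G \times H),\; \psi(G, H),\; \psi(H, G)\,\}.$$
   Context: The direct product $G\times H$ has vertex set $V(G)\times V(H)$, with $(x_1,y_1)$ adjacent to $(x_2,y_2)$ if and only if $x_1x_2\in E(G)$ and $y_1y_2\in E(H)$. An edge-cut of a graph $F$ is a set $S\subseteq E(F)$ such that $F-S$ is disconnected; $\lambda(F)$ (the edge connectivity) is the size of a minimum edge-cut of $F$ (it is $0$ if $F$ is disconnected), and $\delta(F)$ is the minimum degree of $F$. The bipartite edge frustration $\varphi(F)$ is the minimum number of edges whose deletion from $F$ yields a bipartite graph. For $A,B\subseteq V(F)$, $[A,B]$ denotes the set of edges of $F$ with one endvertex in $A$ and the other in $B$, and $[A]$ denotes the subgraph of $F$ induced by $A$. Let $\mathcal{P}(V(F))$ be the set of all partitions $\{A,B\}$ of $V(F)$ into two subsets, one of which may be empty, and define $$\rho(F)=\min\{\,2\varphi([A])+|[A,B]| : \{A,B\}\in\mathcal{P}(V(F)),\ A\neq\emptyset\,\}.$$ For graphs $G,H$ define $\psi(G,H)=\rho(G)|E(H)|+2\varphi(H)|E(G)|$. *)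

(* Defs.v *)
(* A finite simple graph is a symmetric irreflexive
   boolean relation r on a finite vertex type T. *)
From mathcomp Require Import all_boot.
Set Implicit Arguments. Unset Strict Implicit. Unset Printing Implicit Defensive.

Section Graphs.
Variable T : finType.
Implicit Types (r : rel T) (A : {set T}) (S : {set {set T}}).

Definition edges r : {set {set T}} :=
  [set e : {set T} | [exists x, exists y, r x y && (e == [set x; y])]].

Definition del_edges r S : rel T :=
  fun x y => r x y && ([set x; y] \notin S).

Definition disconnected r : bool := [exists x, exists y, ~~ connect r x y].

Definition is_edge_cut r S : bool :=
  (S \subset edges r) && disconnected (del_edges r S).

(* edge connectivity: minimum size of an edge-cut (0 if F is disconnected);
   by convention 0 for graphs with at most one vertex (no edge-cut exists) *)
Definition edge_conn r : nat :=
  \big[minn/#|edges r|]_(S : {set {set T}} | is_edge_cut r S) #|S|.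

Definition degree r (x : T) : nat := #|[set y | r x y]|.

(* minimum degree (0 for the empty graph) *)
Definition min_deg r : nat := \big[minn/#|T|]_(x : T) degree r x.

Definition bipartite r : bool :=
  [exists c : {ffun T -> bool}, [forall x, forall y, r x y ==> (c x != c y)]].

Definition frustration r : nat :=
  \big[minn/#|edges r|]_(S : {set {set T}} |
        (S \subset edges r) && bipartite (del_edges r S)) #|S|.

Definition cut_edges r A (B : {set T}) : {set {set T}} :=
  [set e in edges r | [exists x in A, exists y in B, e == [set x; y]]].

End Graphs.

Definition induced (T : finType) (r : rel T) (A : {set T}) :
    rel {x : T | x \in A} :=
  fun x y => r (val x) (val y).
Arguments induced {T} r A.

Definition rho (T : finType) (r : rel T) : nat :=
  \big[minn/(3 * #|edges r|)]_(A : {set T} | A != set0)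
     (2 * frustration (induced r A) + #|cut_edges r A (~: A)|).

Definition psi (T1 T2 : finType) (rG : rel T1) (rH : rel T2) : nat :=
  rho rG * #|edges rH| + 2 * frustration rH * #|edges rG|.

Definition dprod_graph (T1 T2 : finType) (rG : rel T1) (rH : rel T2) :
    rel (T1 * T2)%type :=
  fun u v => rG u.1 v.1 && rH u.2 v.2.

(* Main.v *)
Require Import Defs.
From mathcomp Require Import all_boot zify.

(* A cut of G x H is a Boolean function f on V(G) x V(H).  Each edge hh' of H contributes
   the cut of G x K2 with sides u = f(.,h), v = f(.,h'); with P = {u <> v} it costs
   2 m(P) + |[P, ~P]| + 2 |cut of ~P by u|, where m(P) counts the
   edges of [P] on which u is constant; this is at least rho(G) if u <> v and at
   least 2 lambda(G) if u = v is not constant; the same holds with G and H exchanged.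
   If no layer over H is constant and H is bipartite, summing over the edges of H gives
   2 lambda(G) |E(H)| or psi(G,H); two opposite constant layers force 2 lambda(G) |E(H)|.
   In all remaining cases one may assume, after complementing f, that no layer is
   identically 1.  Let A and C be the sets of nonzero layers over G and H.  Every edge
   meeting A costs at least 1, and one of cost exactly 1 exhibits a bipartite side of a
   bridge of H inside C, so that at least delta(H)^2 edges of H meet C.  Since at least
   delta(G)^2 / 2 edges of G meet A (or else the edges leaving A already cost
   delta(G) delta(H)), and symmetrically, AM-GM shows that f costs at least
   delta(G) delta(H).  Conversely 2 lambda(G) |E(H)| and delta(G x H) are sizes of evident
   cuts, and psi(G,H) bounds the boundary of {(g, h) : g in A, w(g) = c(h)}, where A and
   the colouring w of [A] realise rho(G) and the colouring c realises phi(H). *)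

Set Implicit Arguments.
Unset Strict Implicit.
Unset Printing Implicit Defensive.

(** * Finite minima with a default value *)

Section BigMin.
Variables (I : finType) (P : pred I) (F : I -> nat) (d : nat).

Lemma bigminn_le_idx : \big[minn/d]_(i | P i) F i <= d.
Proof. by elim/big_rec: _ => // i x _; apply: leq_trans (geq_minr _ _). Qed.

Lemma bigminn_le i0 : P i0 -> \big[minn/d]_(i | P i) F i <= F i0.
Proof.
move=> Pi0; move: (mem_index_enum i0).
elim: (index_enum I) => //= j s IH; rewrite inE big_cons => /predU1P[<-|/IH le_s].
  by rewrite Pi0 geq_minl.
by case: ifP => // _; apply: leq_trans (geq_minr _ _) le_s.
Qed.

(** The default [d] takes part in the minimum; one admissible value at most [d] is what guarantees a
    minimiser. *)
Lemma bigminn_attained i0 : P i0 -> F i0 <= d ->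
  exists2 i, P i & \big[minn/d]_(i | P i) F i = F i.
Proof.
move=> Pi0 le_d.
have [eq_d | //] : \big[minn/d]_(i | P i) F i = d \/
    exists2 i, P i & \big[minn/d]_(i | P i) F i = F i.
  elim/big_rec: _ => [|i x Pi IH]; first by left.
  by rewrite minnE; case: (leqP (F i) x) => cmp; [right; exists i => //; lia |
    have -> : F i - (F i - x) = x by lia].
exists i0 => //; apply/eqP; rewrite eqn_leq bigminn_le //=.
by rewrite eq_d.
Qed.

End BigMin.

(** * Arc sums and edge counting *)

(* Arcs are ordered pairs of adjacent vertices: sums over arcs count every edge twice. *)
Definition arc_sum (T : finType) (r : rel T) (F : T -> T -> nat) : nat :=
  \sum_(p : T * T | r p.1 p.2) F p.1 p.2.

Section ArcSum.
Variables (T : finType) (r : rel T).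
Implicit Types F G : T -> T -> nat.

Lemma arc_sum_le F G : (forall x y, r x y -> F x y <= G x y) ->
  arc_sum r F <= arc_sum r G.
Proof. by move=> FG; apply: leq_sum => p; apply: FG. Qed.

Lemma eq_arc_sum F G : (forall x y, r x y -> F x y = G x y) ->
  arc_sum r F = arc_sum r G.
Proof. by move=> FG; apply: eq_bigr => p; apply: FG. Qed.

Lemma arc_sumD F G :
  arc_sum r (fun x y => F x y + G x y) = arc_sum r F + arc_sum r G.
Proof. exact: big_split. Qed.

Lemma arc_sumMl k F : arc_sum r (fun x y => k * F x y) = k * arc_sum r F.
Proof. by rewrite /arc_sum big_distrr. Qed.

Lemma arc_sumMr k F : arc_sum r (fun x y => F x y * k) = arc_sum r F * k.
Proof. by rewrite /arc_sum big_distrl. Qed.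

Lemma arc_sum_nested F : arc_sum r F = \sum_x \sum_(y | r x y) F x y.
Proof. by rewrite pair_big_dep. Qed.

Lemma arc_sum_mask F : arc_sum r F = \sum_x \sum_y r x y * F x y.
Proof.
rewrite arc_sum_nested; apply: eq_bigr => x _; rewrite big_mkcond /=.
by apply: eq_bigr => y _; case: (r x y); rewrite ?mul1n ?mul0n.
Qed.

Lemma arc_sum_ge1 F x y : r x y -> F x y <= arc_sum r F.
Proof. by move=> rxy; rewrite /arc_sum (bigD1 (x, y)) //= leq_addr. Qed.

Hypothesis symr : symmetric r.

Lemma arc_sumC F : arc_sum r F = arc_sum r (fun x y => F y x).
Proof.
have swapK : involutive (fun p : T * T => (p.2, p.1)) by case.
rewrite /arc_sum (reindex_inj (inv_inj swapK)) /=.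
by apply: eq_bigl => -[x y] /=; rewrite symr.
Qed.

Hypothesis irrr : irreflexive r.

(** Arcs are grouped by underlying edge; by irreflexivity the two orientations differ, so every
    fibre has two elements. *)
Lemma card_edges : arc_sum r (fun _ _ => 1) = 2 * #|edges r|.
Proof.
rewrite /arc_sum (partition_big (fun p => [set p.1; p.2]) (mem (edges r))) /=; last first.
  move=> [x y] /= rxy; rewrite inE; apply/existsP; exists x; apply/existsP; exists y.
  by rewrite rxy /=.
rewrite mulnC -sum_nat_const; apply: eq_bigr => e.
rewrite inE => /existsP[x /existsP[y /andP[rxy /eqP->]]].
have nxy : x != y by apply: contraTneq rxy => ->; rewrite irrr.
rewrite (bigD1 (x, y)) /= ?rxy ?eqxx // (bigD1 (y, x)) /=; last first.
  by rewrite symr rxy setUC eqxx xpair_eqE negb_and eq_sym nxy.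
rewrite big1 // => -[a b] /= /andP[/andP[/andP[rab /eqP ab] n1] n2].
have nab : a != b by apply: contraTneq rab => ->; rewrite irrr.
have /set2P[ax|ay] : a \in [set x; y] by rewrite -ab set21.
  have /set2P[bx|bY] : b \in [set x; y] by rewrite -ab set22.
    by rewrite ax bx eqxx in nab.
  by rewrite ax bY eqxx in n1.
have /set2P[bx|bY] : b \in [set x; y] by rewrite -ab set22.
  by rewrite ay bx eqxx in n2.
by rewrite ay bY eqxx in nab.
Qed.

End ArcSum.

Lemma arc_sum_filter (T : finType) (r p : rel T) :
  arc_sum r (fun x y => p x y) = arc_sum (fun x y => r x y && p x y) (fun _ _ => 1).
Proof.
rewrite !arc_sum_mask; apply: eq_bigr => x _; apply: eq_bigr => y _.
by rewrite muln1 mulnb.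
Qed.

Lemma arc_sum_exchange (T1 T2 : finType) (r1 : rel T1) (r2 : rel T2) F :
  arc_sum r1 (fun x y => arc_sum r2 (F x y)) =
  arc_sum r2 (fun x' y' => arc_sum r1 (fun x y => F x y x' y')).
Proof. by rewrite /arc_sum exchange_big. Qed.

Lemma card_edges_filter (T : finType) (r p : rel T) :
  symmetric r -> irreflexive r -> (forall x y, r x y -> p x y = p y x) ->
  arc_sum r (fun x y => p x y) = 2 * #|edges (fun x y => r x y && p x y)|.
Proof.
move=> symr irrr symp; rewrite arc_sum_filter card_edges //.
  by move=> x y; rewrite symr; case ryx: (r y x) => //=; rewrite symp // symr.
by move=> x; rewrite irrr.
Qed.

Lemma edges_mono (T : finType) (r r' : rel T) : subrel r r' -> edges r \subset edges r'.
Proof.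
move=> rr'; apply/subsetP => e; rewrite !inE => /existsP[x /existsP[y /andP[rxy exy]]].
by apply/existsP; exists x; apply/existsP; exists y; rewrite rr'.
Qed.

Lemma eq_set2 (T : finType) (x y a b : T) : [set x; y] = [set a; b] ->
  x = a /\ y = b \/ x = b /\ y = a.
Proof.
move=> e; have : a \in [set x; y] by rewrite e set21.
have : b \in [set x; y] by rewrite e set22.
have : x \in [set a; b] by rewrite -e set21.
have : y \in [set a; b] by rewrite -e set22.
move=> /set2P[]ey /set2P[]ex /set2P[]eb /set2P[]ea.
all: by [left; split; congruence | right; split; congruence].
Qed.

Lemma mem_edges (T : finType) (r : rel T) x y : symmetric r ->
  ([set x; y] \in edges r) = r x y.
Proof.
move=> symr; rewrite inE; apply/existsP/idP => [[a /existsP[b /andP[rab /eqP e]]]|rxy].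
  by case: (eq_set2 e) => -[-> ->] //; rewrite symr.
by exists x; apply/existsP; exists y; rewrite rxy /=.
Qed.

(** * Cuts and 2-colourings as arc sums *)

Definition crossing (T : finType) (r : rel T) (w : T -> bool) : nat :=
  arc_sum r (fun x y => w x != w y).

Definition monochromatic (T : finType) (r : rel T) (w : T -> bool) : nat :=
  arc_sum r (fun x y => w x == w y).

Section CutsAndColourings.
Variables (T : finType) (r : rel T).
Hypotheses (symr : symmetric r) (irrr : irreflexive r).
Implicit Type w : T -> bool.

(** Once the crossing edges are deleted, [w] is constant on components. *)
Lemma edge_conn_le w x0 y0 : w x0 != w y0 -> 2 * edge_conn r <= crossing r w.
Proof.
move=> wxy; rewrite /crossing card_edges_filter //; last by move=> x y _; rewrite eq_sym.
rewrite leq_pmul2l //; apply: bigminn_le.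
rewrite /is_edge_cut edges_mono /=; last by move=> x y /andP[].
apply/existsP; exists x0; apply/existsP; exists y0; apply: contraNN wxy => con.
suff cl : closed (del_edges r (edges (fun x y => r x y && (w x != w y)))) w.
  by have := closed_connect cl con; rewrite /in_mem /= => ->.
move=> x y /andP[rxy]; rewrite mem_edges ?rxy => [/negPn/eqP //|].
by move=> a b; rewrite symr eq_sym.
Qed.

(** Two distinct vertices make the full edge set a cut, so a minimum cut [S] exists; [w] is a
    component left by [S], and all edges leaving it lie in [S]. *)
Lemma edge_conn_attained (x0 y0 : T) : x0 != y0 ->
  exists w, (exists x y, w x != w y) /\ crossing r w <= 2 * edge_conn r.
Proof.
move=> nxy.
have cutE : is_edge_cut r (edges r).
  rewrite /is_edge_cut subxx /=; apply/existsP; exists x0; apply/existsP; exists y0.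
  apply: contraNN nxy => con.
  have cl : closed (del_edges r (edges r)) (pred1 x0).
    by move=> x y /andP[rxy]; rewrite mem_edges // rxy.
  by have := closed_connect cl con; rewrite !inE eqxx eq_sym => <-.
have [S /andP[sS /existsP[x /existsP[y ncon]]] eqS] :=
  bigminn_attained (F := fun S : {set {set T}} => #|S|) cutE (leqnn #|edges r|).
pose w z := connect (del_edges r S) x z.
exists w; split; first by exists x, y; rewrite /w connect0 (negbTE ncon).
rewrite /crossing card_edges_filter //; last by move=> a b _; rewrite eq_sym.
rewrite leq_pmul2l // /edge_conn eqS; apply: subset_leq_card; apply/subsetP => e.
rewrite inE => /existsP[a /existsP[b /andP[/andP[rab wab] /eqP->]]].
apply: contraNT wab => nS.
have dab : del_edges r S a b by rewrite /del_edges rab.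
have dba : del_edges r S b a by rewrite /del_edges symr rab setUC.
apply/eqP; apply/idP/idP => con; apply: connect_trans con _; exact: connect1.
Qed.

Lemma frustration_le w : 2 * frustration r <= monochromatic r w.
Proof.
rewrite /monochromatic card_edges_filter //.
rewrite leq_pmul2l //; apply: bigminn_le.
rewrite edges_mono /=; last by move=> x y /andP[].
apply/existsP; exists [ffun x => w x]; apply/forallP => x; apply/forallP => y.
apply/implyP => /andP[rxy]; rewrite mem_edges ?rxy ?ffunE //.
by move=> a b; rewrite symr eq_sym.
Qed.

Lemma frustration_attained : exists w, monochromatic r w <= 2 * frustration r.
Proof.
have bipE : (edges r \subset edges r) && bipartite (del_edges r (edges r)).
  rewrite subxx; apply/existsP; exists [ffun=> true]; apply/forallP => x.
  by apply/forallP => y; apply/implyP => /andP[rxy]; rewrite mem_edges // rxy.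
have [S /andP[sS /existsP[c /forallP col]] eqS] :=
  bigminn_attained
    (P := fun S : {set {set T}} => (S \subset edges r) && bipartite (del_edges r S))
    (F := fun S : {set {set T}} => #|S|) bipE (leqnn #|edges r|).
exists c; rewrite /monochromatic card_edges_filter //.
rewrite leq_pmul2l // /frustration eqS; apply: subset_leq_card; apply/subsetP => e.
rewrite inE => /existsP[a /existsP[b /andP[/andP[rab cab] /eqP->]]].
apply: contraLR cab => nS; have /forallP/(_ b)/implyP := col a; apply.
by rewrite /del_edges rab.
Qed.

End CutsAndColourings.

Lemma min_deg_le (T : finType) (r : rel T) x : min_deg r <= degree r x.
Proof. exact: bigminn_le. Qed.

Lemma min_deg_attained (T : finType) (r : rel T) (x0 : T) :
  exists x, degree r x = min_deg r.
Proof.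
have [x _ eqx] := bigminn_attained (F := degree r) (isT : predT x0) (max_card [set y | r x0 y]).
by exists x.
Qed.

(** * The invariant [rho] as an arc sum *)

Section Rho.
Variables (T : finType) (r : rel T).
Hypotheses (symr : symmetric r) (irrr : irreflexive r).

(* Twice the quantity minimised by [rho], for the set [A] coloured by [w]. *)
Definition rho_cost (A w : T -> bool) : nat :=
  arc_sum r (fun x y => 2 * [&& A x, A y & w x == w y] + (A x != A y)).

Lemma big_sig (A : {set T}) (F : T -> nat) :
  \sum_(s : {x : T | x \in A}) F (val s) = \sum_(x in A) F x.
Proof.
rewrite [RHS](reindex_omap (val : {x : T | x \in A} -> T) insub) /=; last first.
  by move=> x Ax; rewrite insubT.
by apply: eq_bigl => s; rewrite valK eqxx (valP s).
Qed.

Lemma monochromatic_induced (A : {set T}) (w : T -> bool) :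
  monochromatic (induced r A) (w \o val) =
  arc_sum r (fun x y => [&& x \in A, y \in A & w x == w y]).
Proof.
rewrite /monochromatic !arc_sum_mask /induced.
rewrite (big_sig A (fun x => \sum_(s : {x | x \in A}) r x (val s) * (w x == w (val s)))).
rewrite big_mkcond; apply: eq_bigr => x _; case: ifP => Ax; last first.
  by rewrite big1 // => y _; rewrite muln0.
rewrite (big_sig A (fun y => r x y * (w x == w y))) big_mkcond; apply: eq_bigr => y _.
by case: ifP => Ay; rewrite ?muln0.
Qed.

Lemma card_cut_edges (A : {set T}) :
  2 * #|cut_edges r A (~: A)| = arc_sum r (fun x y => (x \in A) != (y \in A)).
Proof.
rewrite card_edges_filter //; last by move=> x y _; rewrite eq_sym.
congr (2 * _); apply: eq_card => e; rewrite !inE.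
apply/andP/existsP => [[/existsP[x /existsP[y /andP[rxy /eqP->]]]]|].
  move=> /existsP[a /andP[Aa /existsP[b /andP[]]]]; rewrite inE => nAb /eqP eab.
  exists x; apply/existsP; exists y; rewrite rxy eqxx andbT /=.
  by case: (eq_set2 eab) => -[-> ->]; rewrite Aa (negbTE nAb).
case=> x /existsP[y /andP[/andP[rxy nA] /eqP->]].
have sub a b : r a b -> a \in A -> b \notin A ->
    [exists x in A, exists y in ~: A, [set a; b] == [set x; y]].
  move=> rab Aa nAb; apply/existsP; exists a; rewrite Aa; apply/existsP; exists b.
  by rewrite inE nAb /=.
split; first by apply/existsP; exists x; apply/existsP; exists y; rewrite rxy /=.
case Ax: (x \in A) nA => /=; first by move=> nA; apply: sub.
by rewrite negbK => Ay; rewrite setUC sub // ?Ax // symr.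
Qed.

Lemma rho_costE (A : {set T}) (w : T -> bool) :
  rho_cost (mem A) w =
  2 * monochromatic (induced r A) (w \o val) + 2 * #|cut_edges r A (~: A)|.
Proof. by rewrite monochromatic_induced card_cut_edges -arc_sumMl -arc_sumD. Qed.

Let symI (A : {set T}) : symmetric (induced r A).
Proof. by move=> s t; apply: symr. Qed.

Let irrI (A : {set T}) : irreflexive (induced r A).
Proof. by move=> s; apply: irrr. Qed.

Lemma rho_le (A w : T -> bool) x0 : A x0 -> 2 * rho r <= rho_cost A w.
Proof.
move=> Ax0; pose B := [set x | A x].
have -> : rho_cost A w = rho_cost (mem B) w.
  by apply: eq_arc_sum => x y _; rewrite !inE.
rewrite rho_costE -mulnDr leq_pmul2l //.
have BN0 : B != set0 by apply/set0Pn; exists x0; rewrite inE.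
apply: leq_trans (bigminn_le (P := fun A : {set T} => A != set0) _ _ BN0) _.
rewrite leq_add2r; exact: (frustration_le (@symI B) (@irrI B)).
Qed.

Lemma rho_attained (x0 : T) :
  exists A w : T -> bool, (exists x, A x) /\ rho_cost A w <= 2 * rho r.
Proof.
have TN0 : [set: T] != set0 by apply/set0Pn; exists x0.
(* A constant colouring of the whole vertex set shows that its value is at most 2|E|, hence below
   the default 3|E|. *)
have le_d : 2 * frustration (induced r [set: T]) + #|cut_edges r [set: T] (~: [set: T])|
    <= 3 * #|edges r|.
  rewrite -(leq_pmul2l (isT : 0 < 2)) mulnDr.
  have := frustration_le (@symI [set: T]) (@irrI [set: T]) (predT \o val).
  rewrite monochromatic_induced card_cut_edges mulnCA -card_edges //.
  rewrite (eq_arc_sum (G := fun _ _ => 1)); last by move=> x y _; rewrite !inE.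
  rewrite [X in _ + X](eq_arc_sum (G := fun _ _ => 0)); last by move=> x y _; rewrite !inE.
  by rewrite [X in _ + X]big1 //; lia.
have [A /set0Pn[a Aa] eqA] := bigminn_attained (P := fun A : {set T} => A != set0)
  (F := fun A : {set T} => 2 * frustration (induced r A) + #|cut_edges r A (~: A)|) TN0 le_d.
have [w le_w] := frustration_attained (@symI A) (@irrI A).
(* The extension of [w] by [true] is harmless: [rho_cost] reads the colouring only on [A]. *)
exists (mem A), (fun x => oapp w true (insub x)); split; first by exists a.
have eq_w : monochromatic (induced r A) ((fun x => oapp w true (insub x)) \o val) =
    monochromatic (induced r A) w.
  by apply: eq_arc_sum => s t _; rewrite /= !valK.
by rewrite rho_costE eq_w /rho eqA mulnDr leq_add2r leq_pmul2l.
Qed.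

End Rho.

(** * Cuts of the product with a single edge *)

(* The size of the cut of the direct product of [r] with K2 whose traces on the two
   copies of the vertex set are [u] and [v]. *)
Definition layer_cost (T : finType) (r : rel T) (u v : T -> bool) : nat :=
  arc_sum r (fun x y => u x != v y).

Lemma arc_sum_degree (T : finType) (r : rel T) (p : T -> bool) :
  arc_sum r (fun x _ => p x) = \sum_(x | p x) degree r x.
Proof.
rewrite arc_sum_nested [RHS]big_mkcond; apply: eq_bigr => x _.
by rewrite sum_nat_const mulnC /degree cardsE; case: (p x); rewrite ?mul1n.
Qed.

Section LayerCost.
Variables (T : finType) (r : rel T).
Hypotheses (symr : symmetric r) (irrr : irreflexive r).
Implicit Types u v : T -> bool.

Lemma layer_cost_double u v :
  2 * layer_cost r u v = arc_sum r (fun x y => (u x != v y) + (u y != v x)).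
Proof. by rewrite arc_sumD mul2n -addnn; congr (_ + _); apply: arc_sumC. Qed.

(* Submodularity of the cut function, applied to the intersection and the union
   of the two sides. *)
Lemma layer_cost_edge_conn u v x0 y0 :
  ~~ u x0 -> ~~ v x0 -> u y0 -> v y0 -> 2 * edge_conn r <= layer_cost r u v.
Proof.
move=> ux vx uy vy; rewrite -(leq_pmul2l (isT : 0 < 2)) layer_cost_double.
have leI := edge_conn_le symr irrr (w := fun x => u x && v x) (x0 := x0) (y0 := y0).
have leU := edge_conn_le symr irrr (w := fun x => u x || v x) (x0 := x0) (y0 := y0).
rewrite mul2n -addnn; apply: leq_trans (leq_add (leI _) (leU _)) _.
- by rewrite uy vy (negbTE ux).
- by rewrite uy (negbTE ux) (negbTE vx).
rewrite -arc_sumD; apply: arc_sum_le => x y _.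
by case: (u x); case: (v x); case: (u y); case: (v y).
Qed.

(** In the symmetrised sum, an arc inside the disagreement set contributes 2 exactly when [u] is
    constant on it, and an arc with one end in that set contributes exactly 1. *)
Lemma rho_cost_layer u v : rho_cost r (fun x => u x != v x) u <= 2 * layer_cost r u v.
Proof.
rewrite layer_cost_double; apply: arc_sum_le => x y _.
by case: (u x); case: (v x); case: (u y); case: (v y).
Qed.

Lemma layer_cost_rho u v x0 : u x0 != v x0 -> rho r <= layer_cost r u v.
Proof.
move=> nuv; rewrite -(leq_pmul2l (isT : 0 < 2)).
exact: leq_trans (rho_le symr irrr (A := fun x => u x != v x) u nuv) (rho_cost_layer u v).
Qed.

Lemma layer_cost_frustration u v :
  (forall x, u x != v x) -> 2 * frustration r <= layer_cost r u v.
Proof.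
move=> nuv; apply: leq_trans (frustration_le symr irrr u) _.
apply: arc_sum_le => x y _; have := nuv y.
by case: (u x); case: (v y); case: (u y).
Qed.

Lemma layer_cost_empty u v x0 :
  u x0 -> (forall x, ~~ v x) -> min_deg r <= layer_cost r u v.
Proof.
move=> ux nv; apply: leq_trans (min_deg_le r x0) _.
rewrite /layer_cost (eq_arc_sum (G := fun x _ => u x)); last first.
  by move=> x y _; rewrite (negbTE (nv y)); case: (u x).
by rewrite arc_sum_degree (bigD1 x0) //= leq_addr.
Qed.

Lemma arc_sum_le1_unique (p : rel T) a b c d : arc_sum r (fun x y => p x y) <= 1 ->
  r a b -> p a b -> r c d -> p c d -> (a, b) = (c, d).
Proof.
move=> le1 rab pab rcd pcd; apply/eqP; apply: contraTT le1 => neq.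
rewrite -ltnNge /arc_sum (bigD1 (a, b)) //= (bigD1 (c, d)) /=; last by rewrite rcd eq_sym.
by rewrite pab pcd.
Qed.

(* The vertices where [u] and [v] disagree are then one side of a bridge and are
   properly 2-coloured by [u]; the colour class of the endpoint of the bridge contains
   the neighbourhood of any vertex of the other class. *)
Lemma layer_cost_bridge u v x0 y0 : 0 < edge_conn r -> u x0 != v x0 -> u y0 = v y0 ->
  0 < layer_cost r u v /\
  (layer_cost r u v <= 1 ->
   2 * min_deg r ^ 2 <= arc_sum r (fun x y => (u x != v x) || (u y != v y))).
Proof.
move=> lam_gt0 Px0 Py0; pose P x := u x != v x.
have cost2 := rho_cost_layer u v; rewrite -/P in cost2.
have crossE : crossing r P = 2 * arc_sum r (fun x y => P x && ~~ P y).
  rewrite mul2n -addnn {2}arc_sumC // -arc_sumD; apply: eq_arc_sum => x y _.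
  by case: (P x); case: (P y).
have cross_ge : 2 * edge_conn r <= crossing r P.
  by apply: (edge_conn_le symr irrr (x0 := x0) (y0 := y0)); rewrite /P Px0 Py0 eqxx.
rewrite /rho_cost arc_sumD arc_sumMl -/(crossing r P) in cost2.
(* The arcs leaving [P] and the monochromatic arcs inside [P] together number at most the cost, and
   at least [edge_conn r] arcs leave [P]. *)
split=> [|le1]; first lia.
have out_le1 : arc_sum r (fun x y => P x && ~~ P y) <= 1 by lia.
have mono0 : arc_sum r (fun x y => [&& P x, P y & u x == u y]) = 0 by lia.
have nmono x y : r x y -> P x -> P y -> u x != u y.
  move=> rxy Px Py; apply/negP => uxy.
  have := arc_sum_ge1 (fun x y => [&& P x, P y & u x == u y] : nat) rxy.
  by rewrite mono0 Px Py uxy.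
have : 0 < arc_sum r (fun x y => P x && ~~ P y) by lia.
rewrite lt0n sum_nat_eq0 => /forallPn[[a b]]; rewrite negb_imply /= eqb0 negbK.
case/and3P=> rab Pa nPb.
pose P1 x := P x && (u x == u a).
have P1_ge : min_deg r <= #|P1|.
  (* If [z] in [P] has the other colour, no arc leaves [P] from [z], as the only outgoing arc starts
     at [a]; so all neighbours of [z] lie in [P1]. *)
  case: (pickP (fun z => P z && (u z != u a))) => [z /andP[Pz uz]|none].
    apply: leq_trans (min_deg_le r z) _; apply: subset_leq_card; apply/subsetP => y.
    rewrite inE unfold_in => rzy; have Py : P y.
      apply: contraT => nPy.
      have [az _] : (a, b) = (z, y).
        by apply: arc_sum_le1_unique out_le1 rab _ rzy _; apply/andP.
      by rewrite az eqxx in uz.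
    rewrite /P1 Py /=; have := nmono _ _ rzy Pz Py; move: uz.
    by case: (u z); case: (u y); case: (u a).
  (* Otherwise all of [P] has the colour of [a], so [b] is the only possible neighbour of [a]. *)
  apply: leq_trans (min_deg_le r a) _; apply: (@leq_trans 1); last first.
    by apply/card_gt0P; exists a; rewrite unfold_in /P1 Pa eqxx.
  rewrite -(cards1 b); apply: subset_leq_card; apply/subsetP => y; rewrite !inE => ray.
  case Py: (P y).
    by have := none y; rewrite Py eq_sym nmono.
  have [->] // : (a, b) = (a, y).
  by apply: arc_sum_le1_unique out_le1 rab _ ray _; rewrite ?Pa ?nPb ?Py.
(* [P1] is independent, so its degree sum counts distinct edges, all meeting [P]. *)
apply: (@leq_trans (2 * arc_sum r (fun x _ => P1 x))).
  rewrite leq_pmul2l // arc_sum_degree expnS expn1.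
  apply: leq_trans (leq_mul P1_ge (leqnn _)) _; rewrite -sum_nat_const.
  by apply: leq_sum => x _; apply: min_deg_le.
rewrite mul2n -addnn {2}arc_sumC // -arc_sumD; apply: arc_sum_le => x y rxy.
rewrite /P1 -/(P x) -/(P y); have := nmono x y rxy.
by case: (P x); case: (P y) => nm; try have := nm isT isT;
  case: (u x); case: (u y); case: (u a).
Qed.

(** If [u] and [v] agree at some vertex and disagree at another, the bridge argument applies. If
    they disagree everywhere, positive frustration forces cost at least 2; if they agree everywhere,
    positive edge connectivity does. *)
Lemma layer_cost_dichotomy u v x1 x2 x3 : 0 < edge_conn r ->
  ~~ u x1 -> ~~ v x2 -> u x3 || v x3 -> 0 < frustration r \/ (exists x0, u x0 = v x0) ->
  0 < layer_cost r u v /\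
  (layer_cost r u v <= 1 ->
   2 * min_deg r ^ 2 <= arc_sum r (fun x y => (u x != v x) || (u y != v y))).
Proof.
move=> lam_gt0 ux1 vx2 uv3 cond.
case: (pickP (fun x => u x != v x)) => [x nx | agree].
  case: (pickP (fun x => u x == v x)) => [y /eqP ey | differ].
    exact: layer_cost_bridge nx ey.
  have [phi_gt0|[x0 /eqP]] := cond; last by rewrite differ.
  have := @layer_cost_frustration u v (fun x => negbT (differ x)).
  by split; lia.
have eq_uv x : u x = v x by apply/eqP; have := agree x; case: eqP.
have := @layer_cost_edge_conn u v x1 x3 ux1.
rewrite -!eq_uv orbb in uv3 *; move=> /(_ ux1 uv3 uv3); split; lia.
Qed.

End LayerCost.

Lemma layer_costC (T : finType) (r : rel T) u v : symmetric r ->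
  layer_cost r u v = layer_cost r v u.
Proof.
by move=> symr; rewrite /layer_cost arc_sumC //; apply: eq_arc_sum => x y _; rewrite eq_sym.
Qed.

(** * Cuts of the direct product *)

(* Twice the size of the cut [f] of the direct product. *)
Definition product_cost (T1 T2 : finType) (rG : rel T1) (rH : rel T2)
    (f : T1 -> T2 -> bool) : nat :=
  arc_sum rG (fun g g' => layer_cost rH (f g) (f g')).

Definition touching (T : finType) (r : rel T) (A : T -> bool) : nat :=
  arc_sum r (fun x y => A x || A y).

Lemma product_costC (T1 T2 : finType) (rG : rel T1) (rH : rel T2) f :
  product_cost rG rH f = product_cost rH rG (fun h g => f g h).
Proof. exact: arc_sum_exchange. Qed.

Lemma product_cost_neg (T1 T2 : finType) (rG : rel T1) (rH : rel T2) f :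
  product_cost rG rH (fun g h => ~~ f g h) = product_cost rG rH f.
Proof.
apply: eq_arc_sum => g g' _; apply: eq_arc_sum => h h' _.
by case: (f g h); case: (f g' h').
Qed.

Lemma arc_sum_dprod (T1 T2 : finType) (rG : rel T1) (rH : rel T2) F :
  arc_sum (dprod_graph rG rH) F =
  arc_sum rG (fun g g' => arc_sum rH (fun h h' => F (g, h) (g', h'))).
Proof.
rewrite [RHS]/arc_sum /= pair_big /arc_sum /=.
pose shuffle (q : (T1 * T1) * (T2 * T2)) := ((q.1.1, q.2.1), (q.1.2, q.2.2)).
pose unshuffle (p : (T1 * T2) * (T1 * T2)) := ((p.1.1, p.2.1), (p.1.2, p.2.2)).
rewrite (reindex shuffle) //=; exists unshuffle => [[[a b] [c d]]|[[a b] [c d]]] //.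
Qed.

(** * Lower bound for all cuts *)

Section LowerBound.

(** A vertex of [A] has at most |A| - 1 neighbours in [A], hence at least δ + 1 - |A| outside; and
    a(δ + 1 - a) >= δ for 1 <= a <= δ. *)
Lemma leaving_arcs (T : finType) (r : rel T) (A : T -> bool) x0 :
  irreflexive r -> A x0 -> #|A| <= min_deg r ->
  min_deg r <= arc_sum r (fun x y => A x && ~~ A y).
Proof.
move=> irrr Ax0 leA; have A_gt0 : 0 < #|A| by apply/card_gt0P; exists x0.
apply: (@leq_trans (#|A| * (min_deg r + 1 - #|A|))); first nia.
rewrite arc_sum_nested -sum_nat_const big_mkcond; apply: leq_sum => x _.
rewrite unfold_in; case: ifP => // Ax.
have := cardsID [set y | A y] [set y | r x y]; have := min_deg_le r x; rewrite /degree.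
have : #|[set y | r x y] :&: [set y | A y]| < #|A|.
  apply: proper_card; apply/properP; split.
    by apply/subsetP => y; rewrite !inE unfold_in => /andP[].
  by exists x; rewrite ?inE ?irrr.
have -> : \sum_(y | r x y) (true && ~~ A y) = #|[set y | r x y] :\: [set y | A y]|.
  rewrite -sum1_card [RHS]big_mkcond [LHS]big_mkcond; apply: eq_bigr => y _.
  by rewrite !inE; case: (A y); case: (r x y).
lia.
Qed.

(** The last hypothesis feeds the dichotomy for two layers: where [f] vanishes for every [g], any
    two layers agree. *)
Lemma touching_bounds (T1 T2 : finType) (rG : rel T1) (rH : rel T2)
    (f : T1 -> T2 -> bool) (A := fun g => [exists h, f g h])
    (C := fun h => [exists g, f g h]) (g0 : T1) (h0 : T2) :
  symmetric rG -> irreflexive rG -> symmetric rH -> irreflexive rH ->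
  0 < edge_conn rH -> f g0 h0 -> (forall g, exists h, ~~ f g h) ->
  0 < frustration rH \/ (exists h, forall g, ~~ f g h) ->
  [/\ touching rG A <= product_cost rG rH f,
      2 * touching rG A <= product_cost rG rH f \/ 2 * min_deg rH ^ 2 <= touching rH C &
      min_deg rG ^ 2 <= touching rG A \/
      2 * (min_deg rG * min_deg rH) <= product_cost rG rH f].
Proof.
move=> symG irrG symH irrH lam_gt0 fgh not1 cond.
have dich g g' : A g || A g' -> 0 < layer_cost rH (f g) (f g') /\
    (layer_cost rH (f g) (f g') <= 1 -> 2 * min_deg rH ^ 2 <=
     arc_sum rH (fun x y => (f g x != f g' x) || (f g y != f g' y))).
  move=> Agg; have [x1 fx1] := not1 g; have [x2 fx2] := not1 g'.
  have [x3 fx3] : exists x3, f g x3 || f g' x3.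
    by case/orP: Agg => /existsP[x fx]; exists x; rewrite fx ?orbT.
  apply: layer_cost_dichotomy fx1 fx2 fx3 _ => //.
  case: cond => [|[x none]]; first by left.
  by right; exists x; rewrite (negbTE (none g)) (negbTE (none g')).
split.
- apply: arc_sum_le => g g' _; case Agg: (A g || A g') => //.
  by have [] := dich _ _ Agg.
- case: (pickP (fun p : T1 * T1 => (A p.1 || A p.2) && (layer_cost rH (f p.1) (f p.2) <= 1))).
    move=> [g g'] /andP[/= Agg le1]; right; have [_ /(_ le1) le_touch] := dich _ _ Agg.
    apply: leq_trans le_touch _; apply: arc_sum_le => x y _.
    have inC z : f g z != f g' z -> C z.
      move=> neq; apply/existsP; case fgz: (f g z) neq => neq; first by exists g.
      by exists g'; case: (f g' z) neq.
    by case: (boolP (f g x != f g' x)) => [/inC->|_] //=;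
      case: (boolP (f g y != f g' y)) => [/inC->|_] //=; rewrite orbT.
  move=> ge2; left; rewrite -arc_sumMl; apply: arc_sum_le => g g' _.
  case Agg: (A g || A g') => //.
  by have := ge2 (g, g'); rewrite /= Agg leqNgt /= => /negbFE.
have Ag0 : A g0 by apply/existsP; exists h0.
case: (leqP #|A| (min_deg rG)) => [leA|ltA].
  (* Each arc leaving [A] joins a nonzero layer to a zero one and costs at least δ(H); the two
     orientations give the factor 2. *)
  right; have := leaving_arcs irrG Ag0 leA.
  rewrite -(leq_pmul2l (isT : 0 < 2)) => /leq_mul/(_ (leqnn (min_deg rH))).
  rewrite -mulnA => /leq_trans; apply.
  rewrite mul2n -addnn {2}arc_sumC // -arc_sumD -arc_sumMr; apply: arc_sum_le => g g' _.
  case: (boolP (A g)) => Ag; case: (boolP (A g')) => Ag' //=; rewrite ?mul1n.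
    have /existsP[x fx] := Ag; apply: layer_cost_empty fx _ => y.
    by apply: contraNN Ag' => fy; apply/existsP; exists y.
  rewrite layer_costC //; have /existsP[x fx] := Ag'; apply: layer_cost_empty fx _ => y.
  by apply: contraNN Ag => fy; apply/existsP; exists y.
left; apply: (@leq_trans (arc_sum rG (fun g _ => A g))).
  rewrite arc_sum_degree expnS expn1; apply: leq_trans (leq_mul (ltnW ltA) (leqnn _)) _.
  by rewrite -sum_nat_const; apply: leq_sum => x _; apply: min_deg_le.
by apply: arc_sum_le => g g' _; case: (A g).
Qed.

Variables (T1 T2 : finType) (rG : rel T1) (rH : rel T2).
Hypotheses (symG : symmetric rG) (irrG : irreflexive rG).
Hypotheses (symH : symmetric rH) (irrH : irreflexive rH).
Implicit Type f : T1 -> T2 -> bool.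

Lemma product_cost_min_deg f g0 h0 :
  0 < edge_conn rG -> 0 < edge_conn rH -> f g0 h0 ->
  (forall g, exists h, ~~ f g h) -> (forall h, exists g, ~~ f g h) ->
  0 < frustration rH \/ (exists h, forall g, ~~ f g h) ->
  0 < frustration rG \/ (exists g, forall h, ~~ f g h) ->
  2 * (min_deg rG * min_deg rH) <= product_cost rG rH f.
Proof.
move=> lamG lamH fgh not1G not1H condH condG.
have [] := touching_bounds symG irrG symH irrH lamH fgh not1G condH.
have [] := @touching_bounds _ _ rH rG (fun h g => f g h) h0 g0 symH irrH symG irrG
  lamG fgh not1H condG.
rewrite -product_costC (mulnC (min_deg rH)).
set tG := touching rG _; set tH := touching rH _; set t := product_cost _ _ _.
(* If both alternatives are of the same kind, t >= δ(G)^2 + δ(H)^2. In the mixed cases t >= 4δ^2 for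
   one factor and t >= δ^2 for the other, and the two bounds are multiplied. *)
by move=> leH alt1 [sqH|//] leG alt2 [sqG|//]; case: alt1 => ?; case: alt2 => ?; nia.
Qed.

Lemma product_cost_const f h0 h1 :
  (forall g, ~~ f g h0) -> (forall g, f g h1) ->
  2 * (2 * edge_conn rH * #|edges rG|) <= product_cost rG rH f.
Proof.
move=> f0 f1; rewrite mulnCA -card_edges // -arc_sumMl; apply: arc_sum_le => g g' _.
by rewrite muln1; apply: (@layer_cost_edge_conn _ _ _ _ _ _ h0 h1).
Qed.

(** With G bipartite, [psi rH rG] is ρ(H)|E(G)|. Differing layers cost at least ρ(H); equal ones are
    nonconstant and cost at least 2λ(H). *)
Lemma product_cost_mixed f : frustration rG = 0 ->
  (forall g, exists h, f g h) -> (forall g, exists h, ~~ f g h) ->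
  2 * minn (2 * edge_conn rH * #|edges rG|) (psi rH rG) <= product_cost rG rH f.
Proof.
move=> phi0 ex1 ex0; rewrite /psi phi0 muln0 mul0n addn0 -minnMl.
rewrite mulnCA -card_edges // -arc_sumMl; apply: arc_sum_le => g g' _; rewrite muln1.
case: (pickP (fun h => f g h != f g' h)) => [h neq|agree].
  by rewrite geq_min (layer_cost_rho symH irrH neq) orbT.
have [h0 fh0] := ex0 g; have [h1 fh1] := ex1 g; rewrite geq_min.
have eqf h : f g h = f g' h by apply/eqP; have := agree h; case: eqP.
by rewrite (layer_cost_edge_conn symH irrH (x0 := h0) (y0 := h1)) // -?eqf.
Qed.

End LowerBound.

Lemma product_cost_ge (T1 T2 : finType) (rG : rel T1) (rH : rel T2)
    (f : T1 -> T2 -> bool) g0 h0 g1 h1 :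
  symmetric rG -> irreflexive rG -> symmetric rH -> irreflexive rH ->
  0 < edge_conn rG -> 0 < edge_conn rH -> ~~ f g0 h0 -> f g1 h1 ->
  2 * minn (2 * edge_conn rG * #|edges rH|)
   (minn (2 * edge_conn rH * #|edges rG|)
    (minn (min_deg rG * min_deg rH)
     (minn (psi rG rH) (psi rH rG)))) <= product_cost rG rH f.
Proof.
move=> symG irrG symH irrH lamG lamH f0 f1.
rewrite !minnMr !geq_min.
pose row0 := [exists g, [forall h, ~~ f g h]]; pose row1 := [exists g, [forall h, f g h]].
pose col0 := [exists h, [forall g, ~~ f g h]]; pose col1 := [exists h, [forall g, f g h]].
have row0N : ~~ row0 -> forall g, exists h, f g h.
  by move=> /existsPn no g; have /forallPn[h /negPn] := no g; exists h.
have row1N : ~~ row1 -> forall g, exists h, ~~ f g h.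
  by move=> /existsPn no g; have /forallPn[h] := no g; exists h.
have col0N : ~~ col0 -> forall h, exists g, f g h.
  by move=> /existsPn no h; have /forallPn[g /negPn] := no h; exists g.
have col1N : ~~ col1 -> forall h, exists g, ~~ f g h.
  by move=> /existsPn no h; have /forallPn[g] := no h; exists g.
case: (boolP (row0 && row1)) => [/andP[/existsP[a /forallP a0] /existsP[b /forallP b1]]|nrow].
  have := product_cost_const symH irrH symG irrG (f := fun h g => f g h) a0 b1.
  by rewrite -product_costC => ->.
case: (boolP (col0 && col1)) => [/andP[/existsP[a /forallP a0] /existsP[b /forallP b1]]|ncol].
  by have := product_cost_const symG irrG symH irrH a0 b1 => ->; rewrite orbT.
(* A row and a column share a vertex, so they cannot be constant with opposite values. *)
have nrc : ~~ (row0 && col1).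
  apply/andP => -[/existsP[a /forallP a0] /existsP[b /forallP b1]].
  by have := a0 b; rewrite b1.
have ncr : ~~ (row1 && col0).
  apply/andP => -[/existsP[a /forallP a1] /existsP[b /forallP b0]].
  by have := b0 a; rewrite a1.
case: (boolP [&& frustration rG == 0, ~~ row0 & ~~ row1]) => [/and3P[/eqP phi r0 r1]|nG].
  have := product_cost_mixed symG irrG symH irrH phi (row0N r0) (row1N r1).
  by rewrite minnMr geq_min => /orP[]->; rewrite !orbT.
case: (boolP [&& frustration rH == 0, ~~ col0 & ~~ col1]) => [/and3P[/eqP phi c0 c1]|nH].
  have := product_cost_mixed symH irrH symG irrG (f := fun h g => f g h) phi
    (col0N c0) (col1N c1).
  by rewrite -product_costC minnMr geq_min => /orP[]->; rewrite ?orbT.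
suff : 2 * (min_deg rG * min_deg rH) <= product_cost rG rH f by move=> ->; rewrite ?orbT.
(* If some row or column is identically 1, none is identically 0, so the complement of [f] has no
   layer identically 1. *)
case: (boolP (row1 || col1)) => [one|/norP[r1 c1]].
  have [r0 c0] : ~~ row0 /\ ~~ col0.
    by move: nrow ncol nrc ncr one; case: (row0); case: (row1); case: (col0); case: (col1).
  rewrite -product_cost_neg; apply: (@product_cost_min_deg _ _ _ _ _ _ _ _ _ g0 h0) => //.
  - by move=> g; have [h fgh] := row0N r0 g; exists h; rewrite negbK.
  - by move=> h; have [g fgh] := col0N c0 h; exists g; rewrite negbK.
  - case: (posnP (frustration rH)) nH => [_|]; last by left.
    rewrite c0 /= negbK => /existsP[h /forallP h1'].
    by right; exists h => g; rewrite negbK.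
  - case: (posnP (frustration rG)) nG => [_|]; last by left.
    rewrite r0 /= negbK => /existsP[g /forallP g1'].
    by right; exists g => h; rewrite negbK.
apply: (@product_cost_min_deg _ _ _ _ _ _ _ _ _ g1 h1) => //; first exact: row1N.
- exact: col1N.
- case: (posnP (frustration rH)) nH => [_|]; last by left.
  by rewrite c1 andbT /= negbK => /existsP[h /forallP]; right; exists h.
- case: (posnP (frustration rG)) nG => [_|]; last by left.
  by rewrite r1 andbT /= negbK => /existsP[g /forallP]; right; exists g.
Qed.

(** * Explicit cuts for the upper bound *)

Section UpperBound.
Variables (T1 T2 : finType) (rG : rel T1) (rH : rel T2).
Hypotheses (symG : symmetric rG) (irrG : irreflexive rG).
Hypotheses (symH : symmetric rH) (irrH : irreflexive rH).

Lemma dprod_sym : symmetric (dprod_graph rG rH).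
Proof. by move=> u v; rewrite /dprod_graph symG symH. Qed.

Lemma dprod_irr : irreflexive (dprod_graph rG rH).
Proof. by move=> u; rewrite /dprod_graph irrG. Qed.

Lemma crossing_dprod (w : T1 * T2 -> bool) :
  crossing (dprod_graph rG rH) w = product_cost rG rH (fun g h => w (g, h)).
Proof. exact: arc_sum_dprod. Qed.

Lemma edge_conn_dprod_le (f : T1 -> T2 -> bool) g h g' h' : f g h != f g' h' ->
  2 * edge_conn (dprod_graph rG rH) <= product_cost rG rH f.
Proof.
move=> neq; rewrite -(crossing_dprod (fun u => f u.1 u.2)).
exact: (edge_conn_le dprod_sym dprod_irr (x0 := (g, h)) (y0 := (g', h'))).
Qed.

Lemma card_edges_dprod : #|edges (dprod_graph rG rH)| = 2 * #|edges rG| * #|edges rH|.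
Proof.
apply/eqP; rewrite -(eqn_pmul2l (isT : 0 < 2)) -(card_edges dprod_sym dprod_irr).
rewrite arc_sum_dprod (eq_arc_sum (G := fun _ _ => 1 * arc_sum rH (fun _ _ => 1))).
  by rewrite arc_sumMr !card_edges // mulnCA !mulnA.
by move=> g g' _; rewrite mul1n.
Qed.

Lemma degree_dprod g h : degree (dprod_graph rG rH) (g, h) = degree rG g * degree rH h.
Proof.
rewrite /degree -cardsX; apply: eq_card => -[g' h'].
by rewrite !inE.
Qed.

Lemma min_deg_dprod_le (g : T1) (h : T2) :
  min_deg (dprod_graph rG rH) <= min_deg rG * min_deg rH.
Proof.
have [a <-] := min_deg_attained rG g; have [b <-] := min_deg_attained rH h.
by rewrite -degree_dprod; apply: min_deg_le.
Qed.

Lemma cylinder_cost (w : T1 -> bool) :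
  product_cost rG rH (fun g _ => w g) = crossing rG w * (2 * #|edges rH|).
Proof.
rewrite -card_edges // -arc_sumMr; apply: eq_arc_sum => g g' _.
by rewrite -arc_sumMl; apply: eq_arc_sum => h h' _; rewrite muln1.
Qed.

Lemma cylinder_attained (g0 g1 : T1) (h0 : T2) : g0 != g1 ->
  exists f : T1 -> T2 -> bool, (exists g h g' h', f g h != f g' h') /\
    product_cost rG rH f <= 2 * (2 * edge_conn rG * #|edges rH|).
Proof.
move=> /(edge_conn_attained symG irrG)[w [[g [g' neq]] le_w]].
exists (fun g _ => w g); split; first by exists g, h0, g', h0.
by rewrite cylinder_cost [leqRHS]mulnCA; apply: leq_mul.
Qed.

(** After symmetrising over the arcs of H, the cost splits into a part depending on G only, which
    sums to [rho_cost], and a penalty 2 for each arc on which [c] is constant. *)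
Lemma psi_cost (A w : T1 -> bool) (c : T2 -> bool) :
  rho_cost rG A w <= 2 * rho rG -> monochromatic rH c <= 2 * frustration rH ->
  product_cost rG rH (fun g h => A g && (w g == c h)) <= 2 * psi rG rH.
Proof.
move=> leA leC; rewrite -(leq_pmul2l (isT : 0 < 2)).
pose F g g' := 2 * [&& A g, A g' & w g == w g'] + (A g != A g').
apply: (@leq_trans (arc_sum rG (fun g g' => arc_sum rH (fun h h' =>
    F g g' + 2 * (c h == c h'))))).
  rewrite -arc_sumMl; apply: arc_sum_le => g g' _; rewrite layer_cost_double //.
  apply: arc_sum_le => h h' _; rewrite /F.
  by case: (A g); case: (A g'); case: (w g); case: (w g'); case: (c h); case: (c h').
rewrite (eq_arc_sum (G := fun g g' => F g g' * arc_sum rH (fun _ _ => 1) +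
    1 * (2 * monochromatic rH c))); last first.
  move=> g g' _; rewrite arc_sumD arc_sumMl mul1n; congr (_ + _).
  by rewrite -arc_sumMl; apply: eq_arc_sum => h h' _; rewrite muln1.
rewrite arc_sumD !arc_sumMr !card_edges // -/(rho_cost rG A w) /psi.
have := leq_mul leA (leqnn #|edges rH|); have := leq_mul leC (leqnn #|edges rG|).
nia.
Qed.

Lemma psi_attained (g0 g1 : T1) (h0 : T2) : g0 != g1 ->
  exists f : T1 -> T2 -> bool, (exists g h g' h', f g h != f g' h') /\
    product_cost rG rH f <= 2 * psi rG rH.
Proof.
move=> neq; have [A [w [[a Aa] leA]]] := rho_attained symG irrG g0.
have [c leC] := frustration_attained symH irrH.
case: (pickP (fun h => c h != c h0)) => [h1 neqc|const_c].
  exists (fun g h => A g && (w g == c h)); split; last exact: psi_cost.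
  exists a, h0, a, h1; rewrite Aa /=.
  by move: neqc; case: (w a); case: (c h0); case: (c h1).
(* For constant [c] the set used above might be trivial. But then φ(H) >= |E(H)|, so ψ(G,H) is at
   least the number of edges of the product and any proper cylinder will do. *)
exists (fun g _ => g == g0); split.
  by exists g0, h0, g1, h0; rewrite eqxx (eq_sym g1) (negbTE neq).
have edges_le : #|edges rH| <= frustration rH.
  rewrite -(leq_pmul2l (isT : 0 < 2)); apply: leq_trans leC; rewrite -card_edges //.
  apply: arc_sum_le => h h' _.
  by have := const_c h; have := const_c h'; case: (c h); case: (c h'); case: (c h0).
rewrite cylinder_cost mulnCA leq_pmul2l // /psi.
have crossing_le : crossing rG (eq_op^~ g0) <= 2 * #|edges rG|.
  by rewrite -card_edges //; apply: arc_sum_le => g g' _; case: (_ != _).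
by apply: leq_trans (leq_mul crossing_le edges_le) _; lia.
Qed.

End UpperBound.

(** * Degenerate cases and the final equality *)

Lemma edges_gt0_arc (T : finType) (r : rel T) : 0 < #|edges r| -> exists x y, r x y.
Proof.
case/card_gt0P => e; rewrite inE => /existsP[x /existsP[y /andP[rxy _]]].
by exists x, y.
Qed.

(** The edges at [x] separate it from [y]. *)
Lemma edge_conn_le_degree (T : finType) (r : rel T) x y :
  symmetric r -> irreflexive r -> x != y -> edge_conn r <= degree r x.
Proof.
move=> symr irrr nxy; rewrite -(leq_pmul2l (isT : 0 < 2)).
have neq : pred1 x x != pred1 x y by rewrite /= eqxx (eq_sym y) (negbTE nxy).
apply: leq_trans (edge_conn_le symr irrr neq) _.
have <- : arc_sum r (fun z _ => pred1 x z) = degree r x.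
  by rewrite arc_sum_degree big_pred1_eq.
rewrite mul2n -addnn {2}arc_sumC // -arc_sumD; apply: arc_sum_le => a b _ /=.
by case: (a == x); case: (b == x).
Qed.

Theorem theorem1p1 (T1 T2 : finType) (rG : rel T1) (rH : rel T2)
  (symG : symmetric rG) (irrG : irreflexive rG)
  (symH : symmetric rH) (irrH : irreflexive rH) :
  edge_conn (dprod_graph rG rH) =
  minn (2 * edge_conn rG * #|edges rH|)
   (minn (2 * edge_conn rH * #|edges rG|)
    (minn (min_deg (dprod_graph rG rH))
     (minn (psi rG rH) (psi rH rG)))).
Proof.
(* This settles the case of an edgeless factor, where both sides are 0. *)
have edge_conn_edges : edge_conn (dprod_graph rG rH) <= 2 * #|edges rG| * #|edges rH|.
  by rewrite -card_edges_dprod //; apply: bigminn_le_idx.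
case: (posnP #|edges rG|) => [m0|/edges_gt0_arc[g [g' rgg']]].
  by move: edge_conn_edges; rewrite m0 !muln0 mul0n min0n minn0; case: (edge_conn _).
case: (posnP #|edges rH|) => [n0|/edges_gt0_arc[h [h' rhh']]].
  by move: edge_conn_edges; rewrite n0 !muln0 min0n; case: (edge_conn _).
have ngg' : g != g' by apply: contraTneq rgg' => ->; rewrite irrG.
have nhh' : h != h' by apply: contraTneq rhh' => ->; rewrite irrH.
have symP := dprod_sym symG symH; have irrP := @dprod_irr _ _ rG rH irrG.
have bound k : (exists f : T1 -> T2 -> bool, (exists g h g' h', f g h != f g' h') /\
    product_cost rG rH f <= 2 * k) -> edge_conn (dprod_graph rG rH) <= k.
  case=> f [[a [b [a' [b' neq]]]] le_k]; rewrite -(leq_pmul2l (isT : 0 < 2)).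
  exact: leq_trans (edge_conn_dprod_le symG irrG symH neq) le_k.
have boundC k : (exists f : T2 -> T1 -> bool, (exists h g h' g', f h g != f h' g') /\
    product_cost rH rG f <= 2 * k) -> edge_conn (dprod_graph rG rH) <= k.
  case=> f [[b [a [b' [a' neq]]]] le_k]; apply: bound; exists (fun g h => f h g).
  by split; [exists a, b, a', b' | rewrite product_costC].
apply/eqP; rewrite eqn_leq; apply/andP; split.
  rewrite !leq_min; apply/and5P; split.
  - exact/bound/cylinder_attained/ngg'.
  - exact/boundC/cylinder_attained/nhh'.
  (* Isolating [(a, b)] requires a second vertex; one of [g], [g'] differs from [a]. *)
  - have [[a b] <-] := min_deg_attained (dprod_graph rG rH) (g, h).
    have [eqa|neqa] := eqVneq a g.
      apply: (@edge_conn_le_degree _ _ _ (g', b)) => //.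
      by rewrite xpair_eqE negb_and eqa ngg'.
    by apply: (@edge_conn_le_degree _ _ _ (g, b)); rewrite // xpair_eqE negb_and neqa.
  - exact/bound/psi_attained/ngg'.
  - exact/boundC/psi_attained/nhh'.
(* If λ(G) or λ(H) is 0, so is the right-hand side. *)
case: (posnP (edge_conn rG)) => [->|lamG]; first by rewrite muln0 mul0n min0n.
case: (posnP (edge_conn rH)) => [->|lamH]; first by rewrite muln0 mul0n min0n minn0.
have ngh : (g, h) != (g', h) by rewrite xpair_eqE negb_and ngg'.
have [w [[[a b] [[a' b'] neq]] le_w]] := edge_conn_attained symP irrP ngh.
rewrite -(leq_pmul2l (isT : 0 < 2)); apply: leq_trans le_w.
rewrite crossing_dprod; pose f x y := w (x, y).
have [[x0 [y0 f0]] [x1 [y1 f1]]] :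
    (exists x y, ~~ f x y) /\ (exists x y, f x y).
  rewrite /f; case wab: (w (a, b)) neq => /=; rewrite ?negbK => nw.
    by split; [exists a', b' | exists a, b].
  by split; [exists a, b; rewrite wab | exists a', b'; move: nw; case: (w _)].
apply: leq_trans (product_cost_ge symG irrG symH irrH lamG lamH f0 f1).
rewrite leq_pmul2l // !leq_min !geq_min !leqnn !orbT /=.
by rewrite (min_deg_dprod_le rG rH g h) !orbT.
Qed.
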